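(* Let $\mathcal{G}=(B,a,R)$ be a synchronous grammar and let $L$ be the language of $\mathcal{G}$. Then the map $\phi:\mathrm{L}_{\mathrm{S}}(\mathrm{SG}(\mathcal{G}))\to L$ defined by $\phi((b,\mathfrak{t},u)):=\mathfrak{t}_{b,u}$ is a bijection between the synchronous language of $\mathrm{SG}(\mathcal{G})$ and $L$.
   Context: Bud operads and bud generating systems. A (monochrome) operad $\mathcal{O}=\bigsqcup_{n\geq1}\mathcal{O}(n)$ is a nonsymmetric set-operad with partial compositions $\circ_i:\mathcal{O}(n)\times\mathcal{O}(m)\to\mathcal{O}(n+m-1)$, $1\leq i\leq n$, and a unit $\mathbf{1}\in\mathcal{O}(1)$. For a finite set $\mathscr{C}$ of colors, $\mathbf{Bud}_{\mathscr{C}}(\mathcal{O})$ is the set of triples $(a,x,u)$ with $a\in\mathscr{C}$, $x\in\mathcal{O}(n)$, $u\in\mathscr{C}^n$, $n\geq 1$; $a$ is the output color, $u$ is the word of input colors, and $n$ is the arity. The partial composition $(a,x,u)\circ_i(b,y,v)$ is defined iff $b=u_i$ and equals $(a,x\circ_i y,u')$ with $u'$ obtained from $u$ by replacing its $i$-th letter by $v$. The unit of color $a$ is $\mathbf{1}_a=(a,\mathbf{1},a)$. The complete composition is $x\circ[y_1,\dots,y_n]:=(\cdots((x\circ_n y_n)\circ_{n-1}y_{n-1})\cdots)\circ_1 y_1$, defined when the output color of $y_i$ is the $i$-th input color of $x$ for all $i$. A bud generating system is a tuple $\mathcal{B}=(\mathcal{O},\mathscr{C},\mathfrak{R},I,T)$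 with $\mathcal{O}$ an operad, $\mathscr{C}$ a finite set of colors, $\mathfrak{R}$ a finite subset of $\mathbf{Bud}_{\mathscr{C}}(\mathcal{O})$, and $I,T\subseteq\mathscr{C}$. Write $x_1\leadsto x_2$ if $x_2=x_1\circ[r_1,\dots,r_{|x_1|}]$ for some $r_1,\dots,r_{|x_1|}\in\mathfrak{R}$. The synchronous language $\mathrm{L}_{\mathrm{S}}(\mathcal{B})$ is the set of all $x\in\mathbf{Bud}_{\mathscr{C}}(\mathcal{O})$ such that, for some $a\in I$, $x$ is obtained from $\mathbf{1}_a$ by a finite (possibly empty) sequence of steps $\leadsto$ and all input colors of $x$ are in $T$. Bud trees. $\mathbf{Tree}$ is the free operad generated by exactly one operation $\mathfrak{a}_n$ of arity $n$ for each $n\geq1$: its elements are planar rooted trees whose internal nodes have an arbitrary number $\geq1$ of children, the arity is the number of leaves, the partial composition $\circ_i$ is grafting on the $i$-th leaf, and the unit is the tree consisting of one leaf. For a finite alphabet $B$, a $B$-bud tree is an element of $\mathbf{Bud}_B(\mathbf{Tree})$, i.e. a planar rooted tree whose output (root edge) and leaves are labeled on $B$. For $\mathfrak{t}\in\mathbf{Tree}$, $b\in B$ and $u$ a word on $B$ of length the number of leaves of $\mathfrak{t}$, $\mathfrak{t}_{b,u}$ denotes the $B$-bud tree obtained by labeling the output of $\mathfrak{t}$ by $b$ and its leaves from left to right by the letters of $u$. Synchronous grammars. A synchronous grammar is a tuple $\mathcal{G}=(B,a,R)$ where $B$ is a finite alphabet of bud labels, $a\in B$ is the axiom, and $R$ is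 a finite set of pairs $(b,\mathfrak{s})$ (substitution rules) with $b\in B$ and $\mathfrak{s}$ a $B$-bud tree whose output is labeled by $b$. A $B$-bud tree $\mathfrak{t}_2$ is derivable in one step from a $B$-bud tree $\mathfrak{t}_1$ with $n$ leaves if there are substitution rules $(b_1,\mathfrak{s}_1),\dots,(b_n,\mathfrak{s}_n)\in R$ such that, for all $1\leq i\leq n$, the $i$-th leaf of $\mathfrak{t}_1$ is labeled by $b_i$, and $\mathfrak{t}_2$ is obtained by replacing the $i$-th leaf of $\mathfrak{t}_1$ by $\mathfrak{s}_i$ for all $i$. Derivability is the reflexive and transitive closure. The language of $\mathcal{G}$ is the set of all $B$-bud trees derivable from the tree $\mathbf{1}_a$ consisting of one leaf labeled by $a$ (with output $a$). The construction. $\mathrm{SG}(\mathcal{G})$ is the bud generating system $(\mathbf{Tree},B,\mathfrak{R},\{a\},B)$ with $\mathfrak{R}=\{(b,\mathfrak{t},u)\in\mathbf{Bud}_B(\mathbf{Tree}):(b,\mathfrak{t}_{b,u})\in R\}$. *)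

(* Defs.v *)
From Stdlib Require Import Relations.
From Stdlib Require List.
From mathcomp Require Import all_boot.
From mathcomp Require Import boolp classical_sets functions cardinality.

Set Implicit Arguments.
Unset Strict Implicit.
Unset Printing Implicit Defensive.

Local Open Scope classical_set_scope.

(* Nonsymmetric set-operads.  The disjoint union of the sets O(n) is given by
   its carrier and the arity map.  Inputs are numbered from 0: [op_comp x i y]
   is x o_{i+1} y, and is meaningful only when [i < op_arity x]. *)
Record operad := Operad {
  op_sort :> Type;
  op_arity : op_sort -> nat;
  op_one : op_sort;
  op_comp : op_sort -> nat -> op_sort -> op_sort;
  op_arity_gt0 : forall x, 0 < op_arity x;
  op_arity_one : op_arity op_one = 1;
  op_arity_comp : forall x i y, i < op_arity x ->
    op_arity (op_comp x i y) = (op_arity x + op_arity y).-1;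
  op_one_comp : forall y, op_comp op_one 0 y = y;
  op_comp_one : forall x i, i < op_arity x -> op_comp x i op_one = x;
  op_comp_seq : forall x i y j z, i < op_arity x -> j < op_arity y ->
    op_comp (op_comp x i y) (i + j) z = op_comp x i (op_comp y j z);
  op_comp_par : forall x i y j z, i < j -> j < op_arity x ->
    op_comp (op_comp x i y) (j + op_arity y).-1 z = op_comp (op_comp x j z) i y
}.

Arguments op_arity {o}.
Arguments op_one {o}.
Arguments op_comp {o}.

(* Elements (a, x, u) of Bud_C(O). *)
Record bud (O : operad) (C : finType) := Bud {
  bud_out : C;
  bud_elt : O;
  bud_ins : seq C;
  bud_insP : size bud_ins == op_arity bud_elt
}.

Section BudOperad.
Variables (O : operad) (C : finType).
Implicit Types (x y z : bud O C) (a : C).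

Fact bud_one_subproof a : size [:: a] == op_arity (@op_one O).
Proof. by rewrite op_arity_one. Qed.

Definition bud_one a : bud O C := Bud a (bud_one_subproof a).

Definition bud_composable x i y := onth (bud_ins x) i == Some (bud_out y).

Fact bud_comp_subproof x i y : bud_composable x i y ->
  size (take i (bud_ins x) ++ bud_ins y ++ drop i.+1 (bud_ins x))
    == op_arity (op_comp (bud_elt x) i (bud_elt y)).
Proof.
move=> /eqP xy.
have ix : i < size (bud_ins x) by rewrite -onthTE xy.
rewrite !size_cat size_take size_drop ix op_arity_comp; last first.
  by rewrite -(eqP (bud_insP x)).
rewrite -(eqP (bud_insP x)) -(eqP (bud_insP y)) addnCA subnS.
case: (size (bud_ins x)) ix => // n; rewrite ltnS => ni.
by rewrite subSn //= subnKC // addnC.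
Qed.

Definition bud_comp x i y : option (bud O C) :=
  match @idP (bud_composable x i y) with
  | ReflectT xy => Some (Bud (bud_out x) (bud_comp_subproof xy))
  | ReflectF _ => None
  end.

(* ((x o_n y_n) o_{n-1} ... ) o_1 y_1 with n = |x| and y_{i+1} = [y i];
   the values of [y] outside 0, ..., n-1 play no role. *)
Definition bud_complete x (y : nat -> bud O C) : option (bud O C) :=
  foldr (fun i => obind (fun z => bud_comp z i (y i)))
    (Some x) (iota 0 (op_arity (bud_elt x))).

End BudOperad.

Record bud_system := BudSystem {
  bs_operad : operad;
  bs_color : finType;
  bs_rules : set (bud bs_operad bs_color);
  bs_rules_finite : finite_set bs_rules;
  bs_init : {set bs_color};
  bs_term : {set bs_color}
}.

Definition bs_step (S : bud_system) (x1 x2 : bud (bs_operad S) (bs_color S)) :=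
  exists r : nat -> bud (bs_operad S) (bs_color S),
    (forall i, i < op_arity (bud_elt x1) -> bs_rules (r i))
    /\ bud_complete x1 r = Some x2.

Definition sync_language (S : bud_system) :
    set (bud (bs_operad S) (bs_color S)) :=
  [set x | exists a, [/\ a \in bs_init S,
     clos_refl_trans _ (@bs_step S) (bud_one _ a) x
   & forall c, c \in bud_ins x -> c \in bs_term S]].

(* Planar rooted trees with leaves labeled on A; a node has a first child and
   a possibly empty list of further children, so that a node with n children
   stands for the generator of arity n.  Unlabeled trees are [tree unit]. *)
Inductive tree (A : Type) : Type :=
| Leaf of A
| Node of tree A & seq (tree A).

Fixpoint leaves (A : Type) (t : tree A) : seq A :=
  match t with
  | Leaf a => [:: a]
  | Node c cs => leaves c ++ flatten (map (@leaves A) cs)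
  end.

Definition nleaves (A : Type) (t : tree A) := size (leaves t).

Section MapFrom.
Variables (X Y : Type) (sz : X -> nat) (g : nat -> X -> Y).
Fixpoint map_from (k : nat) (s : seq X) : seq Y :=
  if s is x :: s' then g k x :: map_from (k + sz x) s' else [::].
End MapFrom.

(* Leaves being numbered from left to right starting with k, the leaf
   numbered i is replaced by [f i], for all i simultaneously. *)
Fixpoint subst_from (A A' : Type) (f : nat -> tree A') (k : nat) (t : tree A) :
    tree A' :=
  match t with
  | Leaf _ => f k
  | Node c cs =>
      Node (subst_from f k c)
        (map_from (@nleaves A) (fun j d => subst_from f j d) (k + nleaves c) cs)
  end.

Definition subst (A A' : Type) (t : tree A) (f : nat -> tree A') :=
  subst_from f 0 t.

Definition graft (t : tree unit) (i : nat) (s : tree unit) : tree unit :=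
  subst t (fun j => if j == i then s else Leaf tt).

Section TreeTheory.

Lemma tree_rect_forall (A : Type) (P : tree A -> Prop) :
    (forall a, P (Leaf a)) ->
    (forall c cs, P c -> List.Forall P cs -> P (Node c cs)) ->
  forall t, P t.
Proof.
move=> PL PN; fix IH 1 => -[a|c cs]; first exact: PL.
apply: PN; first exact: IH.
by elim: cs => [|d ds IHds]; constructor.
Qed.

Lemma nleaves_gt0 (A : Type) (t : tree A) : 0 < nleaves t.
Proof.
rewrite /nleaves; elim/tree_rect_forall: t => //= c cs c0 _.
by rewrite size_cat ltn_addr.
Qed.

Lemma leaves_subst_from (A A' : Type) (f : nat -> tree A') k (t : tree A) :
  leaves (subst_from f k t) =
    flatten [seq leaves (f i) | i <- iota k (nleaves t)].
Proof.
elim/tree_rect_forall: t k => [a|c cs IHc IHcs] k; first by rewrite /= cats0.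
rewrite [nleaves (Node _ _)]/nleaves /= size_cat iotaD map_cat flatten_cat IHc; congr (_ ++ _).
rewrite -/(nleaves c); elim: {IHc}cs IHcs (k + _) => //= d ds IHds Hds m.
have [Hd {}Hds] := (List.Forall_inv Hds, List.Forall_inv_tail Hds).
by rewrite size_cat iotaD map_cat flatten_cat Hd IHds.
Qed.

Lemma eq_subst_from (A A' : Type) (f g : nat -> tree A') k (t : tree A) :
  (forall i, k <= i < k + nleaves t -> f i = g i) ->
  subst_from f k t = subst_from g k t.
Proof.
elim/tree_rect_forall: t k => [a|c cs IHc IHcs] k fg /=.
  by apply: fg; rewrite leqnn addn1 /=.
have {}fg i : k <= i < k + (nleaves c + size (flatten (map (@leaves A) cs))) ->
    f i = g i.
  by move=> ki; apply: fg; rewrite [nleaves (Node _ _)]/nleaves /= size_cat.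
congr Node.
  apply: IHc => i /andP[ki ik]; apply: fg.
  by rewrite ki (leq_trans ik) // leq_add2l leq_addr.
have : forall i, k + nleaves c <= i <
    k + nleaves c + size (flatten (map (@leaves A) cs)) -> f i = g i.
  move=> i /andP[ki ik]; apply: fg.
  by rewrite (leq_trans _ ki) ?leq_addr //= addnA.
elim: {IHc fg}cs IHcs (k + _) => //= d ds IHds Hds m fg.
have [Hd {}Hds] := (List.Forall_inv Hds, List.Forall_inv_tail Hds).
rewrite size_cat in fg; congr (_ :: _).
  apply: Hd => i /andP[mi im]; apply: fg.
  by rewrite mi (leq_trans im) // leq_add2l leq_addr.
apply: IHds => // i /andP[mi im]; apply: fg.
by rewrite (leq_trans _ mi) ?leq_addr //= addnA.
Qed.

Lemma subst_fromD (A A' : Type) (f : nat -> tree A') m k (t : tree A) :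
  subst_from f (k + m) t = subst_from (fun i => f (i + m)) k t.
Proof.
elim/tree_rect_forall: t k => [//|c cs IHc IHcs] k /=; congr Node => //.
rewrite addnAC; elim: {IHc}cs IHcs (k + _) => //= d ds IHds Hds n.
have [Hd {}Hds] := (List.Forall_inv Hds, List.Forall_inv_tail Hds).
by rewrite Hd addnAC IHds.
Qed.

Lemma subst_from_tt k (t : tree unit) :
  subst_from (fun=> Leaf tt) k t = t.
Proof.
elim/tree_rect_forall: t k => [[]//|c cs IHc IHcs] k /=; rewrite IHc; congr Node.
elim: {IHc}cs IHcs (k + _) => //= d ds IHds Hds n.
have [Hd {}Hds] := (List.Forall_inv Hds, List.Forall_inv_tail Hds).
by rewrite Hd IHds.
Qed.

(* [o i] is the number of the first leaf of [f i] in the substituted tree. *)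
Lemma subst_from_comp (A A' A'' : Type) (f : nat -> tree A')
    (g : nat -> tree A'') (o : nat -> nat) k (t : tree A) :
    (forall i, o i.+1 = o i + nleaves (f i)) ->
  subst_from g (o k) (subst_from f k t) =
    subst_from (fun i => subst_from g (o i) (f i)) k t.
Proof.
move=> oS.
have oD m n : o m + size (flatten [seq leaves (f i) | i <- iota m n]) = o (m + n).
  elim: n m => [|n IHn] m /=; first by rewrite !addn0.
  by rewrite size_cat addnA -[size (leaves _)]/(nleaves (f m)) -oS IHn addSnnS.
elim/tree_rect_forall: t k => [//|c cs IHc IHcs] k /=; rewrite IHc; congr Node.
rewrite [nleaves (subst_from _ _ _)]/nleaves leaves_subst_from oD.
elim: {IHc}cs IHcs (k + _) => //= d ds IHds Hds n.
have [Hd {}Hds] := (List.Forall_inv Hds, List.Forall_inv_tail Hds).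
by rewrite Hd [nleaves (subst_from _ _ _)]/nleaves leaves_subst_from oD IHds.
Qed.

Fact nleaves_graft t i s : i < nleaves t ->
  nleaves (graft t i s) = (nleaves t + nleaves s).-1.
Proof.
move=> it; have := leaves_subst_from (fun j => if j == i then s else Leaf tt) 0 t.
move/(congr1 size); rewrite -/(subst _ _) -/(graft t i s) -/(nleaves _) => ->.
have [n tE] : exists n, nleaves t = i + n.+1.
  by exists (nleaves t - i.+1); rewrite -subSn // subSS subnKC // ltnW.
rewrite tE iotaD map_cat flatten_cat size_cat add0n /= size_cat eqxx.
have sz1 m p : (forall j, m <= j < m + p -> j != i) ->
    size (flatten [seq leaves (if j == i then s else Leaf tt)
                  | j <- iota m p]) = p.
  elim: p m => //= p IHp m mi.
  rewrite size_cat (negbTE (mi m _)) ?leqnn ?addnS ?ltnS ?leq_addr //=.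
  rewrite IHp // => j /andP[mj jm]; apply: mi.
  by rewrite (ltnW mj) /= -addSnnS.
rewrite !sz1.
- by rewrite -/(nleaves s) addnS addSn /= -addnA [n + _]addnC.
- by move=> j /andP[ij _]; rewrite gtn_eqF.
- by move=> j /andP[_]; rewrite add0n => /ltn_eqF ->.
Qed.

Fact graft_leaf s : graft (Leaf tt) 0 s = s.
Proof. by []. Qed.

Fact graft_one t i : graft t i (Leaf tt) = t.
Proof.
rewrite -[RHS](subst_from_tt 0); apply: eq_subst_from => j _.
by case: eqP.
Qed.

Let off (i : nat) (s : tree unit) j := if j <= i then j else (j + nleaves s).-1.

Let offS i s j :
  off i s j.+1 = off i s j + nleaves (if j == i then s else Leaf tt).
Proof.
rewrite /off; case: ltngtP => [ji|ij|->]; last by rewrite addSn.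
  by rewrite addn1.
by rewrite addn1 addSn /= prednK // addn_gt0 nleaves_gt0 orbT.
Qed.

Let graft_graft t i s j r : graft (graft t i s) j r =
  subst_from (fun l => subst_from (fun m => if m == j then r else Leaf tt)
    (off i s l) (if l == i then s else Leaf tt)) 0 t.
Proof. by rewrite /graft /subst -(subst_from_comp _ _ _ (offS i s)). Qed.

Fact graft_seq t i s j r : j < nleaves s ->
  graft (graft t i s) (i + j) r = graft t i (graft s j r).
Proof.
move=> js; rewrite graft_graft; apply: eq_subst_from => l _.
case: eqP => [->|/eqP li].
  rewrite /off leqnn -[X in subst_from _ X](add0n i) subst_fromD.
  apply: eq_subst_from => m _.
  by rewrite addnC eqn_add2l.
rewrite /= /off; case: ltngtP li => // [li|il] _.
  by rewrite ltn_eqF // ltn_addr.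
rewrite gtn_eqF //; have := nleaves_gt0 s; case: (nleaves s) js => // n.
rewrite ltnS => jn _; rewrite addnS /=.
by rewrite -addSn leq_add.
Qed.

Fact graft_par t i s j r : i < j ->
  graft (graft t i s) (j + nleaves s).-1 r = graft (graft t j r) i s.
Proof.
move=> ij; rewrite !graft_graft; apply: eq_subst_from => l _.
have s0 := nleaves_gt0 s; have r0 := nleaves_gt0 r.
have pD m n : 0 < n -> (m + n).-1 = m + n.-1 by case: n => // n; rewrite addnS.
case: (eqVneq l i) => [->|li].
  rewrite (ltn_eqF ij) /= [in RHS]/off (ltnW ij) eqxx -[RHS](subst_from_tt i).
  rewrite /off leqnn; apply: eq_subst_from => m /andP[_ ms].
  rewrite ltn_eqF // pD // -ltnS -addnS prednK //.
  by apply: leq_ltn_trans ms _; rewrite ltn_add2r.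
case: (eqVneq l j) => [->|lj].
  rewrite /= {1}/off leqNgt ij /= eqxx -[LHS](subst_from_tt j).
  rewrite /off leqnn; apply: eq_subst_from => m /andP[jm _].
  by rewrite gtn_eqF // (leq_trans ij).
rewrite /= /off; case: (ltngtP l i) li => // [{}li|il] _.
  rewrite (leq_trans (ltnW li) (ltnW ij)) !ltn_eqF // pD //.
  by rewrite (ltn_trans li) // ltn_addr.
rewrite !pD // eqn_add2r (negbTE lj); case: leqP => _; rewrite gtn_eqF //.
by rewrite ltn_addr.
Qed.

End TreeTheory.

Definition Tree : operad := Operad
  (@nleaves_gt0 unit) (erefl : nleaves (Leaf tt) = 1) nleaves_graft
  graft_leaf (fun t i _ => graft_one t i)
  (fun t i s j r _ => @graft_seq t i s j r)
  (fun t i s j r ij _ => @graft_par t i s j r ij).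

(* A B-bud tree as a tree carrying its labels: the label of the output and the
   tree with labeled leaves, as opposed to the triples of [bud Tree B]. *)
Record bud_tree (B : Type) := BudTree { bt_out : B; bt_tree : tree B }.

(* t_{b,u}; meaningful when |u| is the number of leaves of t. *)
Definition labeling (B : Type) (t : tree unit) (b : B) (u : seq B) :
    bud_tree B :=
  BudTree b (subst t (fun i => Leaf (nth b u i))).

Definition phi (B : finType) (x : bud Tree B) : bud_tree B :=
  labeling (bud_elt x) (bud_out x) (bud_ins x).

Lemma phi_inj (B : finType) : injective (@phi B).
Proof.
move=> [b t u tu] [b' t' u' tu'] [/= <- E].
have leavesL (s : tree unit) v : size v == nleaves s ->
    leaves (subst s (fun i => Leaf (nth b v i))) = v.
  move=> /eqP sv; rewrite leaves_subst_from -sv flatten_map1.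
  exact: mkseq_nth.
have eraseL (s : tree unit) v :
    subst (subst s (fun i => Leaf (nth b v i))) (fun=> Leaf tt) = s.
  rewrite -[RHS](subst_from_tt 0).
  apply: (@subst_from_comp _ _ _ _ _ id) => i.
  by rewrite addn1.
have Eu : u = u' by rewrite -(leavesL t u tu) -(leavesL t' u' tu') E.
have Et : t = t' by rewrite -(eraseL t u) -(eraseL t' u') E.
by subst; congr Bud; apply: bool_irrelevance.
Qed.

Record sync_grammar := SyncGrammar {
  sg_label : finType;
  sg_axiom : sg_label;
  sg_rules : set (sg_label * bud_tree sg_label);
  sg_rules_finite : finite_set sg_rules;
  sg_rules_out : forall r, sg_rules r -> bt_out r.2 = r.1
}.

Definition sg_step (G : sync_grammar) (t1 t2 : bud_tree (sg_label G)) :=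
  exists r : nat -> sg_label G * bud_tree (sg_label G),
    (forall i, i < nleaves (bt_tree t1) ->
       sg_rules (r i) /\ onth (leaves (bt_tree t1)) i = Some (r i).1)
    /\ t2 = BudTree (bt_out t1)
              (subst (bt_tree t1) (fun i => bt_tree (r i).2)).

Definition sg_language (G : sync_grammar) : set (bud_tree (sg_label G)) :=
  [set t | clos_refl_trans _ (@sg_step G)
             (BudTree (sg_axiom G) (Leaf (sg_axiom G))) t].

Definition SG_rules (G : sync_grammar) : set (bud Tree (sg_label G)) :=
  [set x : bud Tree (sg_label G) |
    sg_rules (bud_out x, labeling (bud_elt x) (bud_out x) (bud_ins x))].

Fact SG_rules_finite (G : sync_grammar) : finite_set (@SG_rules G).
Proof.
apply: (@finite_preimage _ _ _ (fun x => (bud_out x, phi x))).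
  by move=> x y _ _ /(congr1 snd) /phi_inj.
exact: sg_rules_finite.
Qed.

Definition SG (G : sync_grammar) : bud_system :=
  BudSystem (@SG_rules_finite G) [set sg_axiom G]%SET [set: sg_label G]%SET.

(* Main.v *)
Require Import Defs.
From Stdlib Require Import Relations.
From mathcomp Require Import all_boot.
From mathcomp Require Import boolp classical_sets functions cardinality.

(** Both languages are the sets of elements reachable from an axiom by a
    one-step relation, and the terminal condition of [SG G] is void since every
    label is terminal.  It therefore suffices that [phi] be a bijection from
    all bud triples to all labeled trees ([unphiK] and [phi_inj]) that maps the
    axiom to the axiom and preserves and reflects the one-step relations
    ([phi_step]).

    The content of the latter is that the complete composition of the bud
    operad on [Tree], computed by successive graftings from right to left, is
    the simultaneous substitution at all leaves.  After the graftings at the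
    positions [k], ..., [n - 1], the underlying tree is the substitution that
    leaves the first [k] leaves unchanged, and the input word is the prefix of
    length [k] of the original word followed by the input words of the grafted
    elements; this is proved by induction in [partial_completeP].  In
    particular the letter at position [k - 1] is still the original one, so the
    next grafting is defined exactly when the labels match
    ([partial_complete_isSome]). *)

Set Implicit Arguments.
Unset Strict Implicit.
Unset Printing Implicit Defensive.

Local Open Scope classical_set_scope.

(** * Labeled trees as pairs of a shape and a word *)

(** The shape of a labeled tree, obtained by forgetting its leaf labels. *)
Definition erase (A : Type) (t : tree A) : tree unit :=
  subst t (fun=> Leaf tt).

(** Each leaf of [t] is relabeled by the letter at its position in a word that
    contains [leaves t] as a factor starting at the position [size s1] from
    which the leaves are numbered. *)
Lemma subst_from_nth_leaves (A : Type) (b : A) (t : tree A) s1 s2 :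
  subst_from (fun i => Leaf (nth b (s1 ++ leaves t ++ s2) i)) (size s1) t = t.
Proof.
elim/tree_rect_forall: t s1 s2 => [a|c cs IHc IHcs] s1 s2 /=.
  by rewrite nth_cat ltnn subnn.
rewrite -catA IHc; congr Node.
rewrite catA -size_cat.
elim: {IHc}cs IHcs (s1 ++ leaves c) => //= d ds IHds Hds s.
have [Hd {}Hds] := (List.Forall_inv Hds, List.Forall_inv_tail Hds).
by rewrite -catA Hd catA -size_cat IHds.
Qed.

Lemma subst_erase (A A' : Type) (t : tree A) (f : nat -> tree A') :
  subst (erase t) f = subst t f.
Proof.
apply: (@subst_from_comp _ _ _ _ _ id) => i.
by rewrite addn1.
Qed.

Lemma erase_subst (A A' : Type) (t : tree A) (f : nat -> tree A') :
  erase (subst t f) = subst t (fun i => erase (f i)).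
Proof.
pose o i := \sum_(j < i) nleaves (f j).
have o0 : 0 = o 0 by rewrite /o big_ord0.
rewrite /erase {1}/subst o0 (@subst_from_comp _ _ _ f _ o); last first.
  by move=> i; rewrite /o big_ord_recr.
apply: eq_subst_from => i _.
by rewrite -[o i]add0n subst_fromD.
Qed.

Lemma nleaves_erase (A : Type) (t : tree A) : nleaves (erase t) = nleaves t.
Proof.
rewrite /nleaves leaves_subst_from (flatten_map1 (fun=> tt)).
by rewrite size_map size_iota.
Qed.

Lemma subst_erase_leaves (A : Type) (b : A) (t : tree A) :
  subst (erase t) (fun i => Leaf (nth b (leaves t) i)) = t.
Proof.
rewrite subst_erase.
by have := subst_from_nth_leaves b t [::] [::]; rewrite cats0.
Qed.

(** * The bijection between bud triples and labeled trees *)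

Section Phi.
Variable B : finType.
Implicit Types (x y z : bud Tree B) (t : bud_tree B).

Lemma size_bud_ins x : size (bud_ins x) = nleaves (bud_elt x).
Proof. exact/eqP/bud_insP. Qed.

Lemma leaves_phi x : leaves (bt_tree (phi x)) = bud_ins x.
Proof.
rewrite /= leaves_subst_from -size_bud_ins flatten_map1.
exact: mkseq_nth.
Qed.

Lemma erase_phi x : erase (bt_tree (phi x)) = bud_elt x.
Proof. by rewrite /= erase_subst; apply: (@subst_from_tt 0). Qed.

Fact unphi_subproof t :
  size (leaves (bt_tree t)) == @op_arity Tree (erase (bt_tree t)).
Proof. by rewrite /= nleaves_erase. Qed.

(** The inverse of [phi]: the shape of a labeled tree with the word of its leaf
    labels. *)
Definition unphi t : bud Tree B := Bud (bt_out t) (unphi_subproof t).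

Lemma unphiK : cancel unphi (@phi B).
Proof. by case=> b t; rewrite /phi /labeling /= subst_erase_leaves. Qed.

Lemma phiK : cancel (@phi B) unphi.
Proof. by move=> x; apply: phi_inj; rewrite unphiK. Qed.

(** * Complete composition as simultaneous substitution *)

Lemma bud_compE (O : operad) (C : finType) (x : bud O C) i (y z : bud O C) :
  bud_comp x i y = Some z ->
  [/\ bud_composable x i y, bud_out z = bud_out x,
      bud_elt z = op_comp (bud_elt x) i (bud_elt y)
    & bud_ins z = take i (bud_ins x) ++ bud_ins y ++ drop i.+1 (bud_ins x)].
Proof. by rewrite /bud_comp; case: {-}_ / idP => // xy [<-]. Qed.

Lemma bud_comp_isSome (O : operad) (C : finType) (x : bud O C) i (y : bud O C) :
  bud_composable x i y -> bud_comp x i y.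
Proof. by rewrite /bud_comp; case: {-}_ / idP. Qed.

(** The substitution by [f] at the leaves numbered from [k] on. *)
Definition subst_after (t : tree unit) (f : nat -> tree unit) k :=
  subst t (fun j => if j < k then Leaf tt else f j).

(** The leaves before the position [k] being unchanged, the one numbered [k]
    keeps its number after the substitution at the leaves on its right. *)
Lemma graft_subst_after (t : tree unit) f k :
  graft (subst_after t f k.+1) k (f k) = subst_after t f k.
Proof.
pose g j := if j < k.+1 then Leaf tt else f j.
pose o i := \sum_(j < i) nleaves (g j).
have o0 : 0 = o 0 by rewrite /o big_ord0.
have oS i : o i.+1 = o i + nleaves (g i) by rewrite /o big_ord_recr.
have ole i : i <= k.+1 -> o i = i.
  elim: i => [|i IHi] ik; first by rewrite -o0.
  by rewrite oS IHi 1?ltnW // /g ik addn1.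
have ogt d : k < o (d + k.+1).
  elim: d => [|d IHd]; first by rewrite ole.
  by rewrite addSn oS ltn_addr.
rewrite /graft {1}/subst o0 (@subst_from_comp _ _ _ g _ o) //.
apply: eq_subst_from => i _; rewrite /g ltnS.
case: ltngtP => [ik|ki|->].
- by rewrite /= ole ?ltn_eqF // ltnW // ltnS ltnW.
- rewrite -[RHS](subst_from_tt (o i)); apply: eq_subst_from => j /andP[ij _].
  rewrite gtn_eqF //; apply: leq_trans ij.
  by rewrite -(subnK ki).
- by rewrite /= ole // eqxx.
Qed.

(** The part of the complete composition that grafts at the [m] positions from
    [k] on. *)
Definition partial_complete x (y : nat -> bud Tree B) k m : option (bud Tree B) :=
  foldr (fun i => obind (fun z => bud_comp z i (y i))) (Some x) (iota k m).

Lemma onth_take_cat (T : Type) (s1 s2 : seq T) k :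
  k < size s1 -> onth (take k.+1 s1 ++ s2) k = onth s1 k.
Proof.
move=> ks; rewrite -[in RHS](cat_take_drop k.+1 s1) !onth_cat.
by rewrite size_takel // ltnSn.
Qed.

(** Only the inputs numbered from [k] on are replaced, so the prefix of length
    [k] of the input word is kept; this is what makes the next grafting, at the
    position [k - 1], test the original letter. *)
Lemma partial_completeP x (y : nat -> bud Tree B) k m z :
    k + m = op_arity (bud_elt x) -> partial_complete x y k m = Some z ->
  [/\ forall i, k <= i < k + m -> onth (bud_ins x) i = Some (bud_out (y i)),
      bud_out z = bud_out x,
      bud_elt z = subst_after (bud_elt x) (fun i => bud_elt (y i)) k
    & bud_ins z =
        take k (bud_ins x) ++ flatten [seq bud_ins (y i) | i <- iota k m]].
Proof.
elim: m k z => [|m IHm] k z km.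
  move=> [<-]; split=> //.
  - by move=> i /andP[ki]; rewrite addn0 ltnNge ki.
  - rewrite -[LHS](subst_from_tt 0); apply: eq_subst_from => i /andP[_].
    by rewrite add0n -[nleaves _]km addn0 => ->.
  - by rewrite cats0 take_oversize // (eqP (bud_insP x)) -km addn0.
rewrite /partial_complete /= -/(partial_complete x y k.+1 m).
case w_def: partial_complete => [w|//] /= /bud_compE[wy zo zt zi].
rewrite -addSnnS in km.
have [xy wo wt wi] := IHm _ _ km w_def.
have kx : k < size (bud_ins x).
  by rewrite size_bud_ins -[nleaves _]km addSn ltnS leq_addr.
have sk : size (take k.+1 (bud_ins x)) = k.+1 by rewrite size_takel.
have xk : onth (bud_ins x) k = Some (bud_out (y k)).
  by move/eqP: wy; rewrite wi onth_take_cat.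
split.
- move=> i; rewrite leq_eqVlt -addSnnS => /andP[/orP[/eqP<- //|ki] im].
  by apply: xy; rewrite ki.
- by rewrite zo.
- by rewrite zt wt; apply: graft_subst_after.
by rewrite zi wi takel_cat ?sk // take_takel // drop_size_cat.
Qed.

Lemma partial_complete_isSome x (y : nat -> bud Tree B) k m :
    k + m = op_arity (bud_elt x) ->
    (forall i, k <= i < k + m -> onth (bud_ins x) i = Some (bud_out (y i))) ->
  partial_complete x y k m.
Proof.
elim: m k => [//|m IHm] k; rewrite -addSnnS => km xy.
rewrite /partial_complete /= -/(partial_complete x y k.+1 m).
have := IHm _ km; case w_def: partial_complete => [w|] /=; last first.
  by apply=> i /andP[/ltnW ki im]; apply: xy; rewrite ki.
move=> _; have [_ _ _ wi] := partial_completeP km w_def.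
have kn : k < k.+1 + m by rewrite addSn ltnS leq_addr.
apply: bud_comp_isSome; rewrite /bud_composable wi onth_take_cat.
  by rewrite xy ?leqnn.
by rewrite size_bud_ins -[nleaves _]km.
Qed.

(** The complete composition is defined exactly when the output color of each
    [y i] is the corresponding input color of [x], and it is then the
    simultaneous substitution of the labeled trees [phi (y i)]. *)
Lemma bud_completeP x (y : nat -> bud Tree B) z :
  bud_complete x y = Some z <->
    (forall i, i < op_arity (bud_elt x) ->
       onth (bud_ins x) i = Some (bud_out (y i))) /\
    phi z = BudTree (bud_out x)
      (subst (bt_tree (phi x)) (fun i => bt_tree (phi (y i)))).
Proof.
have phiE w : bud_complete x y = Some w ->
    (forall i, i < op_arity (bud_elt x) ->
       onth (bud_ins x) i = Some (bud_out (y i))) /\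
    phi w = BudTree (bud_out x)
      (subst (bt_tree (phi x)) (fun i => bt_tree (phi (y i)))).
  move=> /(partial_completeP (add0n _))[xy wo wt wi]; split=> //.
  (* A labeled tree is determined by its output label, shape and word. *)
  apply: (can_inj unphiK); rewrite phiK.
  suff [wtE wiE] : bud_elt w = erase (subst (bt_tree (phi x))
        (fun i => bt_tree (phi (y i)))) /\
      bud_ins w = leaves (subst (bt_tree (phi x))
        (fun i => bt_tree (phi (y i)))).
    case: w wo wtE wiE {wt wi} => /= b t u tu -> tE uE.
    by subst t u; congr Bud; apply: bool_irrelevance.
  rewrite erase_subst -subst_erase erase_phi wt; split.
    by apply: eq_subst_from => i _; rewrite erase_phi.
  rewrite leaves_subst_from -[nleaves _]/(size _) leaves_phi wi take0 /=.
  rewrite size_bud_ins; congr flatten; apply: eq_map => i.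
  by rewrite leaves_phi.
split=> [/phiE //|[xy zE]].
have := partial_complete_isSome (add0n _) xy.
rewrite /partial_complete -/(bud_complete x y).
case w_def: bud_complete => [w|//] _; congr Some.
by apply: phi_inj; rewrite zE; case: (phiE _ w_def).
Qed.

End Phi.

(** * Derivations *)

Section Derivations.
Variable G : sync_grammar.
Implicit Types x z : bud Tree (sg_label G).

Lemma phi_step x z : sg_step (phi x) (phi z) <-> @bs_step (SG G) x z.
Proof.
have nx : nleaves (bt_tree (phi x)) = op_arity (bud_elt x).
  by rewrite -[LHS]/(size _) leaves_phi size_bud_ins.
split=> [[r [r_rule zE]]|[r [r_rule /bud_completeP[xr zE]]]].
  have r_ok i : i < op_arity (bud_elt x) ->
      sg_rules (r i) /\ onth (bud_ins x) i = Some (r i).1.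
    by rewrite -nx -leaves_phi => /r_rule.
  exists (fun i => unphi (r i).2); split=> [i /r_ok[ri _]|].
    rewrite /= /SG_rules /= -/(phi (unphi (r i).2)) unphiK (sg_rules_out ri).
    by rewrite -surjective_pairing.
  apply/bud_completeP; split=> [i /r_ok[ri ->]|].
    by rewrite /= (sg_rules_out ri).
  rewrite zE; congr BudTree; apply: eq_subst_from => i _.
  by rewrite unphiK.
exists (fun i => (bud_out (r i), phi (r i))); split=> // i.
rewrite nx leaves_phi => ix; split; last exact: xr.
exact: (r_rule i ix).
Qed.

Lemma phi_derivable x z :
  clos_refl_trans _ (@sg_step G) (phi x) (phi z) <->
  clos_refl_trans _ (@bs_step (SG G)) x z.
Proof.
split=> [|xz]; last first.
  elim: {x z}xz => [x z xz|x|x y z _ xy _ yz].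
  - by apply: rt_step; apply/phi_step.
  - exact: rt_refl.
  - exact: rt_trans xy yz.
rewrite -{2}[x]phiK -{2}[z]phiK.
elim=> [t u tu|t|t u v _ tu _ uv].
- by apply: rt_step; apply/phi_step; rewrite !unphiK.
- exact: rt_refl.
- exact: rt_trans tu uv.
Qed.

Lemma sync_languageE x : sync_language (S := SG G) x <-> sg_language (phi x).
Proof.
split=> [[a [/set1P-> /phi_derivable]]//|ax].
exists (sg_axiom G); split; first exact: set11.
  exact/phi_derivable.
by move=> c _; rewrite inE.
Qed.

End Derivations.

Theorem proposition2p3p3 (G : sync_grammar) :
  set_bij (@sync_language (SG G)) (@sg_language G) (@phi (sg_label G)).
Proof.
split.
- by move=> x /sync_languageE.
- by move=> x y _ _; apply: phi_inj.
- move=> t tL; exists (unphi t); last exact: unphiK.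
  by apply/sync_languageE; rewrite unphiK.
Qed.
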